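(* Let $M$ be a topological manifold of dimension $n \geq 2$, and let $p_1, p_2 \in M$ be any choice of base points. Then the wedge sum $M \vee M$, formed by gluing the point $p_1$ of the first copy of $M$ to the point $p_2$ of the second copy of $M$, is not a topological manifold (of any dimension).
   Context: A topological manifold of dimension $n$ is a topological space $M$ that is second countable, Hausdorff and locally Euclidean of dimension $n$: every $p \in M$ has an open neighborhood $U \subseteq M$ that is homeomorphic to $\mathbb{R}^n$. In particular, manifolds are without boundary; they are not assumed compact or connected. A topological manifold is a space that is a topological manifold of dimension $m$ for some $m \geq 0$. For topological spaces $X$ and $Y$ with chosen points $x \in X$ and $y \in Y$, the wedge sum $X \vee Y$ is the quotient space $(X \coprod Y)/(x \sim y)$ of the disjoint union obtained by identifying $x$ with $y$, with the quotient topology. *)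

(* Defs.v *)
From HB Require Import structures.
From mathcomp Require Import all_boot all_order all_algebra.
From mathcomp Require Import all_classical all_reals all_analysis.
From mathcomp Require Import wedge_sigT.

Set Implicit Arguments.
Unset Strict Implicit.
Unset Printing Implicit Defensive.

Import numFieldNormedType.Exports.
Local Open Scope classical_set_scope.
Local Open Scope ring_scope.

Definition homeomorphic (X Y : topologicalType) : Prop :=
  exists (f : X -> Y) (g : Y -> X),
    [/\ continuous f, continuous g, cancel f g & cancel g f].

Definition locally_euclidean (R : realType) (n : nat) (M : topologicalType)
    : Prop :=
  forall p : M, exists U : set M,
    [/\ open U, U p & homeomorphic (set_type U) 'rV[R]_n].

Definition topological_manifold_dim (R : realType) (n : nat)
    (M : topologicalType) : Prop :=
  [/\ @second_countable M, hausdorff_space M & locally_euclidean R n M].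

Definition topological_manifold (R : realType) (M : topologicalType) : Prop :=
  exists m : nat, topological_manifold_dim R m M.

Definition wedge_base (X Y : topologicalType) (x : X) (y : Y) :
    forall b : bool, (if b then X else Y : topologicalType) :=
  fun b => if b return (if b then X else Y : topologicalType) then x else y.

(* The two-space case of the library's [wedge]: the disjoint union is the sigma
   type over [bool], with [X] at [true] and [Y] at [false]. *)
Definition wedge_sum (X Y : topologicalType) (x : X) (y : Y)
    : topologicalType :=
  wedge (wedge_base x y).

(* Main.v *)
Require Import Defs.
From mathcomp Require Import all_boot all_order all_algebra.
From mathcomp Require Import all_classical all_reals all_analysis.
From mathcomp Require Import wedge_sigT lra.

(** The obstruction sits at the gluing point [w].  Suppose that an open
neighbourhood [U] of [w] in the wedge sum is homeomorphic to [R^m].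

If [2 <= m], then [U] minus [w] is connected, being the image of [R^m] minus a
point ([connected_convexD1]).  But [w] separates the two copies of [M] near
itself: the map that collapses the second copy to its base point and the map
that collapses the first one are continuous on the wedge sum, and the two sets
on which they differ from the base points are disjoint open sets covering the
complement of [w].  Both sets meet [U], because no point of [M] is isolated, so
[U] minus [w] is disconnected
([punctured_nbhs_wedge_disconnected]).

If [m < 2], then [R^m] injects continuously into [R].  A chart of [M] at [p1],
followed by the inclusion of the first copy and by [U -> R^m -> R], restricts to
a continuous injection of a convex open subset of [R^n] into [R].  As [2 <= n],
there is none ([no_continuous_injection_real]): take three points of the convex
set and remove the one with the middle value; what is left is connected, yet
its image misses a value between two of its values.

Both cases thus rest on one fact, that a convex open set of dimension at least
two stays connected when a point is removed; invariance of dimension is needed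
only against dimensions zero and one, where this fact provides it. *)

Set Implicit Arguments.
Unset Strict Implicit.
Unset Printing Implicit Defensive.

Import Order.TTheory GRing.Theory Num.Theory.
Import numFieldNormedType.Exports.
Local Open Scope classical_set_scope.
Local Open Scope ring_scope.

(** * Convex open sets with a point removed *)

Section convex.
Context {R : realType} {V : normedModType R}.
Implicit Types (a b c d e : V) (A : set V).

Definition line_segment a c : set V :=
  [set t *: a + (1 - t) *: c | t in `[0, 1]%classic].

(** Dimension at least two, in the form in which it is used: no line through
the origin is the whole space. *)
Definition dim_gt1 := forall v : V, exists e : V, forall k : R, e != k *: v.

Lemma line_segmentl a c : line_segment a c a.
Proof.
exists 1; first by rewrite set_itvE/= lexx ler01.
by rewrite subrr scale0r scale1r addr0.
Qed.

Lemma line_segmentr a c : line_segment a c c.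
Proof.
exists 0; first by rewrite set_itvE/= lexx ler01.
by rewrite subr0 scale0r scale1r add0r.
Qed.

Lemma line_segment_connected a c : connected (line_segment a c).
Proof.
apply: connected_continuous_connected; first exact: segment_connected.
apply: continuous_subspaceT => t.
apply: cvgD; apply: cvgZr_tmp; first exact: cvg_id.
by apply: cvgB; [exact: cvg_cst|exact: cvg_id].
Qed.

Lemma convex_line_segment A a c :
  convex_set A -> A a -> A c -> line_segment a c `<=` A.
Proof.
move=> cA Aa Ac _ [t + <-]; rewrite set_itvE/= => /andP[t0 t1].
by have /set_mem := cA a c (Itv01 t0 t1) (mem_set Aa) (mem_set Ac).
Qed.

Lemma line_segment_affine a b c : line_segment a c b ->
  exists t : R, t *: (a - b) + (1 - t) *: (c - b) = 0.
Proof.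
move=> [t _ bE]; exists t; rewrite !scalerBr addrACA bE -opprD -scalerDl.
by rewrite [t + _]addrC subrK scale1r subrr.
Qed.

Lemma affine_collinear a b c (t : R) : a != b -> c != b ->
  t *: (a - b) + (1 - t) *: (c - b) = 0 -> exists k : R, a - b = k *: (c - b).
Proof.
move=> ab cb; have [->|t0 tE] := eqVneq t 0.
  rewrite scale0r add0r subr0 scale1r => /eqP; rewrite subr_eq0.
  by rewrite (negbTE cb).
exists (- (t^-1 * (1 - t))); apply: (scalerI t0).
by rewrite scalerA mulrN mulVKf// scaleNr; apply/eqP; rewrite -addr_eq0 tE.
Qed.

Lemma line_segment_avoids x b e (r : R) :
  x != b -> r != 0 -> (forall k : R, e != k *: (x - b)) ->
  ~ line_segment x (b + r *: e) b.
Proof.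
move=> xb r0 eN /line_segment_affine[t].
rewrite addrAC subrr add0r scalerA => tE.
have [t1|t1] := eqVneq ((1 - t) * r) 0.
  move: tE; rewrite t1 scale0r addr0 => /eqP; rewrite scaler_eq0 subr_eq0.
  rewrite (negbTE xb) orbF => /eqP t0.
  by move: t1; rewrite t0 subr0 mul1r => /eqP; rewrite (negbTE r0).
have /eqP := eN (- (((1 - t) * r)^-1 * t)); apply.
apply: (scalerI t1); rewrite scalerA mulrN mulVKf// scaleNr.
by apply/eqP; rewrite -addr_eq0 addrC tE.
Qed.

Lemma open_offset A b e : open A -> A b ->
  exists2 r : R, r != 0 & A (b + r *: e).
Proof.
move=> oA Ab.
have : (b + r *: e) @[r --> (0 : R)] --> b.
  rewrite -[X in _ --> X]addr0 -[X in _ --> _ + X](scale0r e).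
  by apply: cvgD; [exact: cvg_cst|apply: cvgZr_tmp; exact: cvg_id].
move=> /(_ A (open_nbhs_nbhs (conj oA Ab))) /nbhs_ballP[d /= d0 dA].
exists (d / 2); first by rewrite gt_eqF// divr_gt0.
apply: dA; rewrite -ball_normE/= sub0r normrN gtr0_norm ?divr_gt0//.
by rewrite ltr_pdivrMr// ltr_pMr// ltr1n.
Qed.

(** Two points are joined by their segment, unless the removed point [b] lies
on it; in that case they are collinear with [b], and a detour through a point
near [b] but off that line avoids [b]. *)
Lemma connected_convexD1 A b :
  dim_gt1 -> open A -> convex_set A -> connected (A `\ b).
Proof.
move=> dimV oA cA.
have link a c : (A `\ b) a -> (A `\ b) c ->
    exists S, [/\ connected S, S a, S c & S `<=` A `\ b].
  move=> [Aa /eqP ab] [Ac /eqP cb].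
  have [/[dup] acb|nacb] := pselect (line_segment a c b); last first.
    exists (line_segment a c); split;
      [exact: line_segment_connected|exact: line_segmentl
      |exact: line_segmentr|].
    move=> x acx; split; first exact: convex_line_segment acx.
    by move=> xb; rewrite xb in acx.
  have Ab : A b by exact: convex_line_segment acb.
  move=> /line_segment_affine[t /(affine_collinear ab cb)[l lE]].
  have [e eN] := dimV (c - b).
  have [r r0 Ad] := open_offset e oA Ab.
  have avoid x k : A x -> x != b -> x - b = k *: (c - b) ->
      line_segment x (b + r *: e) `<=` A `\ b.
    move=> Ax xb xE y xy; split; first exact: convex_line_segment xy.
    move=> yb; move: xy; rewrite yb; apply: line_segment_avoids => // k'.
    by rewrite xE scalerA.
  exists (line_segment a (b + r *: e) `|` line_segment c (b + r *: e)); split.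
  - apply: connectedU; [|exact: line_segment_connected..].
    by exists (b + r *: e); split; exact: line_segmentr.
  - by left; exact: line_segmentl.
  - by right; exact: line_segmentl.
  - rewrite subUset; split; first exact: avoid lE.
    by apply: (avoid _ 1) => //; rewrite scale1r.
have [->|/set0P[a Aba]] := eqVneq (A `\ b) set0; first exact: connected0.
suff -> : A `\ b = connected_component (A `\ b) a.
  exact: component_connected.
apply/seteqP; split; last exact: connected_component_sub.
move=> c /(link _ _ Aba)[S [cS Sa Sc SA]].
exact: (connected_component_max Sa SA cS).
Qed.

(** Of three values of [f], one lies strictly between the two others.  Without
the point where it is taken the domain is still connected, so the intermediate
value theorem produces a second point with that value. *)
Lemma no_continuous_injection_real A b (f : V -> R) :
  dim_gt1 -> open A -> convex_set A -> A b ->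
  {in A, continuous f} -> {in A &, injective f} -> False.
Proof.
move=> dimV oA cA Ab cf injf.
have key x y z : A x -> A y -> A z -> f x < f y -> f y < f z -> False.
  move=> Ax Ay Az xy yz.
  have /connected_intervalP itv : connected (f @` (A `\ y)).
    apply: connected_continuous_connected; first exact: connected_convexD1.
    apply: continuous_in_subspaceT => w /set_mem[Aw _].
    by apply: cf; exact: mem_set.
  have [||| w [Aw +] wy] := itv (f x) (f z) _ _ (f y) _.
  - by exists x => //; split=> // xy'; rewrite xy' ltxx in xy.
  - by exists z => //; split=> // zy; rewrite zy ltxx in yz.
  - by rewrite !ltW.
  - by apply; apply: injf wy; exact: mem_set.
have [e eN] := dimV 0.
have e0 : e != 0 by rewrite -(scale0r 0) eN.
have [r r0 Ac] := open_offset e oA Ab.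
(* The three points: [b], a point [c] of [A] near it, and their midpoint. *)
set c := b + r *: e in Ac.
have Am : A (2^-1 *: b + (1 - 2^-1) *: c).
  apply: (convex_line_segment cA Ab Ac); exists 2^-1 => //.
  by rewrite set_itvE/=; lra.
set m := (_ + _) in Am.
have cb : c != b.
  by rewrite -subr_eq0 addrAC subrr add0r scaler_eq0 negb_or r0.
have half : (1 - 2^-1 : R) = 2^-1 by lra.
have mb : m != b.
  rewrite -subr_eq0 /m half /c scalerDr addrA -scalerDl.
  rewrite (_ : 2^-1 + 2^-1 = 1 :> R); last by lra.
  rewrite scale1r addrAC subrr add0r !scaler_eq0 !negb_or r0 e0 andbT/=.
  by rewrite andbT invr_neq0.
have mc : m != c.
  rewrite -subr_eq0 /m scalerBl scale1r addrCA -scalerBr addrAC subrr add0r.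
  by rewrite scaler_eq0 negb_or subr_eq0 (eq_sym b) cb invr_neq0.
have fneq x y : A x -> A y -> x != y -> f x != f y.
  by move=> Ax Ay; apply: contra_neq; apply: injf; exact: mem_set.
have := fneq _ _ Am Ab mb; have := fneq _ _ Am Ac mc.
have := fneq _ _ Ac Ab cb.
rewrite !neq_lt => /orP[] cb' /orP[] mc' /orP[] mb'.
(* Six of the eight sign patterns are orderings; the other two are cyclic. *)
all: first [lra | exact: (key b c m) | exact: (key b m c)
  | exact: (key c b m) | exact: (key c m b) | exact: (key m b c)
  | exact: (key m c b)].
Qed.

Lemma convex_open_nbhs (N : set V) c : open N -> N c ->
  exists A : set V, [/\ open A, convex_set A, A c & A `<=` N].
Proof.
move=> oN Nc; have [B cB [oB]] := @locally_convex R V.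
move=> /(_ c N (open_nbhs_nbhs (conj oN Nc)))[A [BA Ac] AN].
by exists A; split=> //; [exact: oB|apply: cB; exact: mem_set].
Qed.

End convex.

Arguments dim_gt1 {R} V.

Lemma rV_dim_gt1 (R : realType) n : (2 <= n)%N -> dim_gt1 'rV[R]_n.
Proof.
case: n => [|[|n]] // _ v.
have [v0|v0] := eqVneq (v 0 0) 0.
  exists (delta_mx 0 0) => k; apply/eqP => /rowP/(_ 0).
  by rewrite !mxE v0 mulr0 !eqxx => /eqP; rewrite oner_eq0.
exists (delta_mx 0 1) => k; apply/eqP => /rowP ev.
have := ev 0; rewrite !mxE/= => /esym/eqP.
rewrite mulf_eq0 (negbTE v0) orbF => /eqP k0.
by have := ev 1; rewrite !mxE !eqxx k0 mul0r => /eqP; rewrite oner_eq0.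
Qed.

Lemma rV_continuous_injection_real (R : realType) m : (m < 2)%N ->
  exists2 f : 'rV[R]_m -> R, continuous f & injective f.
Proof.
case: m => [|[|]] // _.
  exists (fun=> 0); first exact: cst_continuous.
  by move=> a b _; apply/rowP => -[].
exists (fun a => a 0 0); first exact: coord_continuous.
by move=> a b ab; apply/rowP => i; rewrite !ord1.
Qed.

(** * The wedge sum near its gluing point *)

Lemma open_disjoint_separated (T : topologicalType) (A B : set T) :
  open A -> open B -> A `&` B = set0 -> separated A B.
Proof.
move=> oA oB AB0; split; rewrite -subset0 => z.
  move=> [clA Bz].
  by have := clA _ (open_nbhs_nbhs (conj oB Bz)); rewrite AB0 => -[].
move=> [Az /(_ A (open_nbhs_nbhs (conj oA Az)))].
by rewrite setIC AB0 => -[].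
Qed.

Lemma open_preim_not_isolated (Z W : topologicalType) (i : Z -> W) (z : Z)
    (U : set W) :
  continuous i -> open U -> U (i z) -> ~ open [set z] ->
  exists2 a, U (i a) & a <> z.
Proof.
move=> ci oU Uiz noz; apply: contrapT => /forall2NP iU; apply: noz.
rewrite (_ : [set z] = i @^-1` U).
  by apply: open_comp => // ? _; exact: ci.
apply/seteqP; split=> [a -> //|a /= Uia].
by have [|/contrapT] := iU a.
Qed.

Section wedge_sum.
Context {X Y : topologicalType} (x : X) (y : Y).

Definition wedge_inl : X -> wedge_sum x y :=
  @wedge_lift _ _ (wedge_base x y) true.

Definition wedge_inr : Y -> wedge_sum x y :=
  @wedge_lift _ _ (wedge_base x y) false.

(** The retractions onto the two summands do two jobs: they show that the
inclusions are injective, and as continuous maps they make the two sides of the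
gluing point open, so that the quotient topology need not be unfolded. *)
Definition wedge_foldl : wedge_sum x y -> X :=
  @wedge_fun _ _ (wedge_base x y) X
    (fun i => if i return ((if i then X else Y : topologicalType) -> X)
              then id else fun=> x).

Definition wedge_foldr : wedge_sum x y -> Y :=
  @wedge_fun _ _ (wedge_base x y) Y
    (fun i => if i return ((if i then X else Y : topologicalType) -> Y)
              then fun=> y else id).

Lemma wedge_inl_continuous : continuous wedge_inl.
Proof. exact: (@wedge_lift_continuous _ _ (wedge_base x y) true). Qed.

Lemma wedge_inr_continuous : continuous wedge_inr.
Proof. exact: (@wedge_lift_continuous _ _ (wedge_base x y) false). Qed.

Lemma wedge_foldl_continuous : continuous wedge_foldl.
Proof.
apply: wedge_fun_continuous; last by move=> [] [].
by move=> []; [move=> ?; exact: cvg_id|exact: cst_continuous].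
Qed.

Lemma wedge_foldr_continuous : continuous wedge_foldr.
Proof.
apply: wedge_fun_continuous; last by move=> [] [].
by move=> []; [exact: cst_continuous|move=> ?; exact: cvg_id].
Qed.

Lemma wedge_inlK : cancel wedge_inl wedge_foldl.
Proof.
by move=> a; rewrite /wedge_foldl /wedge_inl wedge_lift_funE//; move=> [] [].
Qed.

Lemma wedge_inrK : cancel wedge_inr wedge_foldr.
Proof.
by move=> a; rewrite /wedge_foldr /wedge_inr wedge_lift_funE//; move=> [] [].
Qed.

Lemma wedge_foldl_inr b : wedge_foldl (wedge_inr b) = x.
Proof.
by rewrite /wedge_foldl /wedge_inr wedge_lift_funE//; move=> [] [].
Qed.

Lemma wedge_foldr_inl a : wedge_foldr (wedge_inl a) = y.
Proof.
by rewrite /wedge_foldr /wedge_inl wedge_lift_funE//; move=> [] [].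
Qed.

Lemma wedge_glue : wedge_inl x = wedge_inr y.
Proof. exact: (@wedge_liftE _ _ (wedge_base x y) false y true x). Qed.

Lemma wedge_sum_cover (z : wedge_sum x y) :
  (exists a, z = wedge_inl a) \/ (exists b, z = wedge_inr b).
Proof.
have : [set: wedge_sum x y] z by [].
rewrite -(wedgeTE (wedge_base x y)) => -[[] _ [a _ <-]]; [left|right];
  by exists a.
Qed.

Lemma wedge_sides_separated : closed [set x] -> closed [set y] ->
  separated (wedge_foldl @^-1` ~` [set x]) (wedge_foldr @^-1` ~` [set y]).
Proof.
move=> clx cly; apply: open_disjoint_separated.
- apply: open_comp; last exact: closed_openC.
  by move=> z _; exact: wedge_foldl_continuous.
- apply: open_comp; last exact: closed_openC.
  by move=> z _; exact: wedge_foldr_continuous.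
rewrite -subset0 => z [/= zx zy].
have [[a az]|[b bz]] := wedge_sum_cover z.
  by apply: zy; rewrite az wedge_foldr_inl.
by apply: zx; rewrite bz wedge_foldl_inr.
Qed.

Lemma wedge_sides_cover : ~` [set wedge_inl x] `<=`
  (wedge_foldl @^-1` ~` [set x]) `|` (wedge_foldr @^-1` ~` [set y]).
Proof.
move=> z /= zw; have [[a az]|[b bz]] := wedge_sum_cover z; [left|right].
  by rewrite az wedge_inlK => ax; apply: zw; rewrite az ax.
by rewrite bz wedge_inrK => yb; apply: zw; rewrite bz yb wedge_glue.
Qed.

(** Since the base points are not isolated, [U] contains points on both sides
of the gluing point. *)
Lemma punctured_nbhs_wedge_disconnected (U : set (wedge_sum x y)) :
  closed [set x] -> closed [set y] -> ~ open [set x] -> ~ open [set y] ->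
  open U -> U (wedge_inl x) -> ~ connected (U `\ wedge_inl x).
Proof.
move=> clx cly nox noy oU Uw cU.
have [a Ua ax] := open_preim_not_isolated wedge_inl_continuous oU Uw nox.
rewrite wedge_glue in Uw.
have [b Ub yb] := open_preim_not_isolated wedge_inr_continuous oU Uw noy.
have UaD : (U `\ wedge_inl x) (wedge_inl a).
  by split=> // /(can_inj wedge_inlK).
have UbD : (U `\ wedge_inl x) (wedge_inr b).
  by split=> //; rewrite wedge_glue => /(can_inj wedge_inrK).
have [] := connected_subset (wedge_sides_separated clx cly) _ cU.
- by move=> z [_]; exact: wedge_sides_cover.
- by move=> /(_ _ UbD); rewrite /= wedge_foldl_inr.
- by move=> /(_ _ UaD); rewrite /= wedge_foldr_inl.
Qed.

End wedge_sum.

(** * Charts *)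

Lemma euclidean_chart (R : realType) n (M : topologicalType) (p : M) :
  locally_euclidean R n M -> exists (phi : 'rV[R]_n -> M) c,
    [/\ continuous phi, injective phi & phi c = p].
Proof.
move=> /(_ p)[U [_ Up [h [k [_ ck hk kh]]]]].
exists (set_val \o k), (h (exist _ p (mem_set Up))); split.
- by move=> a; apply: continuous_comp; [exact: ck|exact: initial_continuous].
- by apply: inj_comp; [exact: val_inj|exact: can_inj kh].
- by rewrite /= hk.
Qed.

Lemma locally_euclidean_not_isolated (R : realType) n (M : topologicalType)
    (p : M) : (0 < n)%N -> locally_euclidean R n M -> ~ open [set p].
Proof.
case: n => // n _ /(euclidean_chart p)[phi [c [cphi iphi pc]]] op.
have opc : open (phi @^-1` [set p]) by apply: open_comp => // ? _; exact: cphi.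
have [r r0 /= pe] := open_offset (const_mx 1) opc pc.
have /iphi/rowP/(_ 0)/eqP := etrans pe (esym pc).
by rewrite !mxE mulr1 -subr_eq0 addrAC subrr add0r (negbTE r0).
Qed.

(** [U] carries its subspace topology, so [q] remains continuous when its
codomain is restricted to [U]; the default value [u0] makes the restricted map
total. *)
Lemma insubd_continuous (T W : topologicalType) (U : set W) (u0 : U)
    (q : T -> W) : continuous q -> open U ->
  {in q @^-1` U, continuous (fun t => insubd u0 (q t) : U)}.
Proof.
have valE t : U (q t) -> set_val (insubd u0 (q t) : U) = q t.
  by move=> ?; exact/insubdK/mem_set.
move=> cq oU t /set_mem Ut B [_ [[C oC <-] /=]]; rewrite valE// => Cqt CB.
have : nbhs t (q @^-1` (C `&` U)).
  by apply: cq; apply: open_nbhs_nbhs; split; [exact: openI|].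
apply: filterS => t' [Cqt' Uqt']; apply: CB.
by rewrite /= valE.
Qed.

Theorem theorem2p1 (R : realType) (n : nat) (M : topologicalType) (p1 p2 : M)
    (hn : (2 <= n)%N) (hM : topological_manifold_dim R n M) :
  ~ topological_manifold R (wedge_sum p1 p2).
Proof.
have [_ haus eucl] := hM.
have cl1 (p : M) : closed [set p].
  exact: (accessible_closed_set1 (hausdorff_accessible haus)).
pose w := wedge_inl p1 p2 p1.
move=> [m [_ _ /(_ w)[U [oU Uw [h [k [ch ck hk kh]]]]]]].
pose u : U := exist _ w (mem_set Uw).
have [m2|m2] := leqP 2 m.
  have noi (p : M) : ~ open [set p].
    exact: locally_euclidean_not_isolated (ltnW hn) eucl.
  apply: (punctured_nbhs_wedge_disconnected
    (cl1 p1) (cl1 p2) (noi p1) (noi p2) oU Uw).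
  have -> : U `\ w = (set_val \o k) @` ([set: 'rV[R]_m] `\ h u).
    apply/seteqP; split=> [z [Uz zw]|_ [a [_ ahu] <-]].
      exists (h (exist _ z (mem_set Uz))); last by rewrite /= hk.
      by split=> // /(can_inj hk)/(congr1 set_val).
    split; first exact: set_valP.
    by move=> kaw; apply: ahu; rewrite -[a]kh; congr h; exact: val_inj.
  apply: connected_continuous_connected.
    by apply: connected_convexD1 => //; [exact: rV_dim_gt1|exact: openT].
  apply: continuous_subspaceT => a.
  by apply: continuous_comp; [exact: ck|exact: initial_continuous].
have [phi [c [cphi iphi pc]]] := euclidean_chart p1 eucl.
have [g cg ig] := rV_continuous_injection_real R m2.
pose q := wedge_inl p1 p2 \o phi.
have cq : continuous q.
  move=> a; apply: continuous_comp; first exact: cphi.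
  exact: wedge_inl_continuous.
have oqU : open (q @^-1` U) by apply: open_comp => // ? _; exact: cq.
have qUc : (q @^-1` U) c by rewrite /q /= pc.
have [A [oA cA Ac AU]] := convex_open_nbhs oqU qUc.
apply: (@no_continuous_injection_real _ _ A c
  (g \o h \o (fun t => insubd u (q t)))) => //.
- exact: rV_dim_gt1.
- move=> t /set_mem/AU qUt; apply: continuous_comp; last first.
    by apply: continuous_comp; [exact: ch|exact: cg].
  by apply: insubd_continuous => //; exact: mem_set.
- move=> s t /set_mem/AU qUs /set_mem/AU qUt /= /ig/(can_inj hk)/(congr1 val).
  by rewrite !insubdK ?inE// => /(can_inj (@wedge_inlK _ _ _ _))/iphi.
Qed.
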